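(* Let $\|\cdot\|$ be a norm on $\mathbb{R}^n$ such that $\mathcal{G}_{\|\cdot\|}\subset S^{n-1}$. Then $\|\cdot\|$ is decomposable if and only if for every $x\in\mathbb{R}^n\setminus\{0\}$ and every $a_1\in\operatorname{argmax}_{a\in\mathcal{G}_{\|\cdot\|}}\langle a,x\rangle$ there exist $a_2,\ldots,a_k\in\mathcal{G}_{\|\cdot\|}$ (for some $k\ge 1$) such that $\{a_1,a_2,\ldots,a_k\}$ is an orthogonal set satisfying the following two conditions: (I) there exist $\gamma_1,\ldots,\gamma_k>0$ such that $x=\sum_{i=1}^k\gamma_i a_i$ and $\|x\|=\sum_{i=1}^k\gamma_i$; (II) for all real $\eta_1,\ldots,\eta_k$ with $|\eta_i|\le 1$ for $i=1,\ldots,k$, one has $\left\|\sum_{i=1}^k\eta_i a_i\right\|^*\le 1$. Moreover, (when $\|\cdot\|$ is decomposable) if $\{a_1,\ldots,a_k\}\subset\mathcal{G}_{\|\cdot\|}$ satisfies (I) and (II) for $x$, then $e_x=\sum_{i=1}^k a_i$.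
   Context: $\mathbb{R}^n$ is equipped with the inner product $\langle x,y\rangle=x^TBy$ for a fixed symmetric positive definite matrix $B$; orthogonality and $\perp$ are with respect to it, $\|x\|_2=\sqrt{\langle x,x\rangle}$, and $S^{n-1}=\{x:\|x\|_2=1\}$. For a norm $\|\cdot\|$ on $\mathbb{R}^n$, the dual norm is $\|y\|^*=\sup\{\langle y,x\rangle:\|x\|\le1\}$, $\mathcal{G}_{\|\cdot\|}$ is the set of extreme points of the unit ball $\{x:\|x\|\le 1\}$, and $\partial\|x\|$ is the subdifferential of the norm at $x$ with respect to $\langle\cdot,\cdot\rangle$, i.e. $\partial\|x\|=\{z:\|y\|\ge\|x\|+\langle z,y-x\rangle\ \forall y\in\mathbb{R}^n\}$. The norm $\|\cdot\|$ is called decomposable if for every $x\in\mathbb{R}^n$ there exist a subspace $T_x\subseteq\mathbb{R}^n$ and a vector $e_x\in T_x$ such that $$\partial\|x\|=\{e_x+v : v\in T_x^{\perp},\ \|v\|^*\le 1\}.$$ (When they exist, $T_x$ and $e_x$ are uniquely determined.) *)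

(* Defs.v *)
From mathcomp Require Import all_boot all_order all_algebra.
From mathcomp Require Import all_classical all_reals.

Set Implicit Arguments.
Unset Strict Implicit.
Unset Printing Implicit Defensive.

Import Order.TTheory GRing.Theory Num.Theory.
Local Open Scope classical_set_scope.
Local Open Scope ring_scope.

Section InnerProduct.
Variables (R : realType) (n : nat) (B : 'M[R]_n).

Definition sym_posdef : Prop :=
  B^T = B /\ forall x : 'cV[R]_n, x != 0 -> 0 < (x^T *m B *m x) 0 0.

Definition inner (x y : 'cV[R]_n) : R := (x^T *m B *m y) 0 0.

Definition norm2 (x : 'cV[R]_n) : R := Num.sqrt (inner x x).

Definition sphere : set 'cV[R]_n := [set x | norm2 x = 1].

Definition orth (T : {vspace 'cV[R]_n}) : set 'cV[R]_n :=
  [set v | forall t, t \in T -> inner t v = 0].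

End InnerProduct.

(* Norms are plain functions, so that an arbitrary norm does not interfere with
   the canonical (sup) norm that the libraries put on matrices. *)
Record is_norm (R : realType) (n : nat) (N : 'cV[R]_n -> R) : Prop := IsNorm {
  norm_triangle : forall x y, N (x + y) <= N x + N y ;
  norm_homog : forall (c : R) x, N (c *: x) = `|c| * N x ;
  norm_definite : forall x, N x = 0 -> x = 0
}.

Section Norm.
Variables (R : realType) (n : nat) (B : 'M[R]_n) (N : 'cV[R]_n -> R).

Definition unit_ball : set 'cV[R]_n := [set x | N x <= 1].

(* [sup] is the real-valued supremum; for a norm [N] the set is nonempty and
   bounded, so its junk value is never used. *)
Definition dual_norm (y : 'cV[R]_n) : R := sup [set inner B y x | x in unit_ball].

Definition extreme_points (C : set 'cV[R]_n) : set 'cV[R]_n :=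
  [set a | C a /\ forall u v (t : R), C u -> C v -> 0 < t -> t < 1 ->
                    a = (1 - t) *: u + t *: v -> u = a /\ v = a].

Definition atoms : set 'cV[R]_n := extreme_points unit_ball.

Definition argmax_atoms (x : 'cV[R]_n) : set 'cV[R]_n :=
  [set a | atoms a /\ forall b, atoms b -> inner B b x <= inner B a x].

Definition subdiff (x : 'cV[R]_n) : set 'cV[R]_n :=
  [set z | forall y, N x + inner B z (y - x) <= N y].

(* The pair [(T, e)] is [(T_x, e_x)]. *)
Definition decomposed_at (x : 'cV[R]_n) (T : {vspace 'cV[R]_n}) (e : 'cV[R]_n) :
    Prop :=
  e \in T /\
  subdiff x = [set e + v | v in [set v | orth B T v /\ dual_norm v <= 1]].

Definition decomposable : Prop := forall x, exists T e, decomposed_at x T e.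

Definition orthogonal_family k (a : 'I_k -> 'cV[R]_n) : Prop :=
  forall i j, i != j -> inner B (a i) (a j) = 0.

Definition atomic_rep k (a : 'I_k -> 'cV[R]_n) (x : 'cV[R]_n) : Prop :=
  exists g : 'I_k -> R, [/\ forall i, 0 < g i,
    x = \sum_(i < k) g i *: a i & N x = \sum_(i < k) g i].

Definition dual_bounded k (a : 'I_k -> 'cV[R]_n) : Prop :=
  forall h : 'I_k -> R, (forall i, `|h i| <= 1) ->
    dual_norm (\sum_(i < k) h i *: a i) <= 1.

End Norm.

(* Main.v *)
Require Import Defs.
From HB Require Import structures.
From mathcomp Require Import all_boot all_order all_algebra.
From mathcomp Require Import all_classical all_reals.
From mathcomp Require Import topology normedtype derive.
From mathcomp Require Import ring lra zify.
Import Order.TTheory GRing.Theory Num.Theory.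
Local Open Scope classical_set_scope.
Local Open Scope ring_scope.

(** Write [polar z] for [dual_norm z <= 1]. Linear forms attain their maximum
on the unit ball at atoms, and atoms have Euclidean norm 1, so by
Cauchy-Schwarz every atom is polar.

If the norm is decomposable, then at an atom [a] the center [e_a] is [a]
itself: [<e_a, e_a> = <e_a, a> = 1 = <a, a>]. For [a1] in the argmax at [x] and
[c = <x, a1>], the vector [x / c] lies in the subdifferential at [a1], so
[x - c a1] lies in the orthogonal of [T_a1]. Every subspace of this form
contains the atoms maximizing any of its nonzero vectors, so the greedy
decomposition can be iterated inside subspaces of decreasing dimension.

Conversely, given the atoms [a_i] of [x], put [e = sum a_i]; then
[z] is in the subdifferential at [x] iff [z] is polar and [<z, a_i> = 1] for all
[i]. Applying the hypothesis to such a [z] and the atom [a_i], of coefficient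
[<z, a_i> = 1], shows that the coefficient of [a_i] may be changed to any value
in [[-1, 1]] within the polar. Doing this for all [i] shows that the
[v] with [e + eps v] polar for some [eps > 0] and [<v, a_i> = 0] form a
subspace, and that [e + v] is polar as soon as [v] is; [T_x] is its orthogonal. *)

Set Implicit Arguments.
Unset Strict Implicit.

(** * Inner product algebra, orthogonal subspaces and Riesz representation *)

Section Inner.
Variables (R : realType) (n : nat) (B : 'M[R]_n).
Hypothesis hB : sym_posdef B.
Local Notation V := ('cV[R]_n).
Local Notation "<< x , y >>" := (inner B x y).

Lemma innerC (x y : V) : <<x, y>> = <<y, x>>.
Proof.
have /matrixP/(_ 0 0) : (y^T *m B *m x)^T = x^T *m B *m y.
  by rewrite !trmx_mul trmxK hB.1 mulmxA.
by rewrite mxE.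
Qed.

Lemma innerDr (x y z : V) : <<x, y + z>> = <<x, y>> + <<x, z>>.
Proof. by rewrite /inner mulmxDr mxE. Qed.

Lemma innerZr (c : R) (x y : V) : <<x, c *: y>> = c * <<x, y>>.
Proof. by rewrite /inner -scalemxAr mxE. Qed.

Lemma innerNr (x y : V) : <<x, - y>> = - <<x, y>>.
Proof. by rewrite -scaleN1r innerZr mulN1r. Qed.

Lemma inner0r (x : V) : <<x, 0>> = 0.
Proof. by rewrite -[0 in LHS](scale0r 0) innerZr mul0r. Qed.

Lemma innerBr (x y z : V) : <<x, y - z>> = <<x, y>> - <<x, z>>.
Proof. by rewrite innerDr innerNr. Qed.

Lemma inner_sumr (x : V) k (h : 'I_k -> R) (a : 'I_k -> V) :
  <<x, \sum_i h i *: a i>> = \sum_i h i * <<x, a i>>.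
Proof.
elim/big_rec2: _ => [|i s t _ IH]; first exact: inner0r.
by rewrite innerDr innerZr IH.
Qed.

Lemma innerDl (x y z : V) : <<x + y, z>> = <<x, z>> + <<y, z>>.
Proof. by rewrite innerC innerDr !(innerC z). Qed.

Lemma innerZl (c : R) (x y : V) : <<c *: x, y>> = c * <<x, y>>.
Proof. by rewrite innerC innerZr innerC. Qed.

Lemma innerNl (x y : V) : <<- x, y>> = - <<x, y>>.
Proof. by rewrite innerC innerNr innerC. Qed.

Lemma inner0l (x : V) : <<0, x>> = 0.
Proof. by rewrite innerC inner0r. Qed.

Lemma innerBl (x y z : V) : <<x - y, z>> = <<x, z>> - <<y, z>>.
Proof. by rewrite innerDl innerNl. Qed.

Lemma inner_suml (x : V) k (h : 'I_k -> R) (a : 'I_k -> V) :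
  <<\sum_i h i *: a i, x>> = \sum_i h i * <<a i, x>>.
Proof. by rewrite innerC inner_sumr; apply: eq_bigr => i _; rewrite innerC. Qed.

Definition innerE :=
  (innerDl, innerDr, innerNl, innerNr, innerZl, innerZr, inner0l, inner0r).

Lemma inner_ge0 (x : V) : 0 <= <<x, x>>.
Proof.
by have [->|/hB.2/ltW//] := eqVneq x 0; rewrite inner0r.
Qed.

Lemma inner_eq0 (x : V) : <<x, x>> = 0 -> x = 0.
Proof. by have [//|/hB.2 + xx0] := eqVneq x 0; rewrite -/(<<x, x>>) xx0 ltxx. Qed.

Lemma sphere_inner (x : V) : sphere B x -> <<x, x>> = 1.
Proof.
by rewrite /sphere /norm2 /= => xx; rewrite -[LHS]sqr_sqrtr ?inner_ge0// xx expr1n.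
Qed.

Lemma sphere_inner_le1 (x y : V) : sphere B x -> sphere B y -> <<x, y>> <= 1.
Proof.
move=> /sphere_inner xx /sphere_inner yy.
have := inner_ge0 (x - y); rewrite !innerE xx yy (innerC y); lra.
Qed.

Lemma inner_orthonormal_sum k (a : 'I_k -> V) (h : 'I_k -> R) i :
  (forall i, sphere B (a i)) -> orthogonal_family B a ->
  <<\sum_l h l *: a l, a i>> = h i.
Proof.
move=> sa oa; rewrite inner_suml (bigD1 i)//= big1 => [|l li].
  by rewrite sphere_inner// mulr1 addr0.
by rewrite oa// mulr0.
Qed.

(** A subspace inside [P] is enlarged by a vector of [P] outside it until none is left; [d] bounds
    the remaining codimension. *)
Lemma vspace_of_pred (P : V -> Prop) :
  P 0 -> (forall (c : R) u v, P u -> P v -> P (c *: u + v)) ->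
  exists U : {vspace V}, forall v, v \in U <-> P v.
Proof.
move=> P0 PD.
suff H d : forall U : {vspace V}, (forall v, v \in U -> P v) ->
    (\dim {:V} - \dim U <= d)%N ->
    exists U : {vspace V}, forall v, v \in U <-> P v.
  apply: (H (\dim {:V}) 0%VS); last by rewrite leq_subr.
  by move=> v; rewrite memv0 => /eqP ->.
elim: d => [|d IH] U UP dU.
  exists U => v; split=> [/UP//|_].
  suff -> : U = fullv by rewrite memvf.
  by apply/eqP; rewrite eqEdim subvf/= -subn_eq0 -leqn0.
have [PU|/existsNP[v /not_implyP[Pv /negP vU]]] := pselect (forall v, P v -> v \in U).
  by exists U => v; split; [exact: UP|exact: PU].
apply: (IH (U + <[v]>)%VS).
  move=> w /memv_addP[u /UP Pu [w' /vlineP[c ->] ->]].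
  by rewrite addrC; apply: PD.
have sUv : (\dim U < \dim (U + <[v]>)%VS)%N.
  rewrite ltn_neqAle dimvS ?addvSl// andbT; apply: contra vU => /eqP dE.
  have /eqP -> : U == (U + <[v]>)%VS by rewrite eqEdim addvSl -dE leqnn.
  by apply: subvP (addvSr _ _) _ _; rewrite memv_line.
move: (dimvS (subvf (U + <[v]>)%VS)) sUv dU => /=; lia.
Qed.

Lemma orth_linear (T : {vspace V}) :
  exists U : {vspace V}, forall v, v \in U <-> orth B T v.
Proof.
apply: vspace_of_pred => [t _|c u v Tu Tv t tT]; first exact: inner0r.
by rewrite !innerE Tu// Tv// mulr0 addr0.
Qed.

(** A row [r] of the left kernel satisfies [r *m B = 0], so [r^T] has inner square 0. *)
Lemma posdef_unitmx : B \in unitmx.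
Proof.
rewrite -row_free_unit -kermx_eq0; apply/eqP/row_matrixP => i; rewrite row0.
set r := row i _; have rB : r *m B = 0 by rewrite -row_mul mulmx_ker row0.
suff : r^T = 0 by move/(congr1 trmx); rewrite trmxK trmx0.
by apply: inner_eq0; rewrite /inner trmxK rB mul0mx mxE.
Qed.

Lemma riesz (f : {linear V -> R^o}) : exists t, forall u, f u = <<t, u>>.
Proof.
exists (invmx B *m \col_i f (delta_mx i 0)) => u.
rewrite innerC /inner mulmxA mulmxK ?posdef_unitmx// mxE.
rewrite {1}[u]matrix_sum_delta linear_sum/=; apply: eq_bigr => i _.
by rewrite big_ord1 linearZ/= !mxE.
Qed.

(* If [v] is orthogonal to [T] but not in [U], a coordinate of the projection
   along [U] vanishes on [U] and not at [v]; represent it by a vector of [T]. *)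
Lemma orth_complement (U : {vspace V}) : exists T : {vspace V},
  (forall v, orth B T v <-> v \in U) /\ forall e, orth B U e -> e \in T.
Proof.
have [T TP] := orth_linear U; exists T; split=> [v|e /TP//].
split=> [Tv|vU t /TP /(_ _ vU)]; last by rewrite innerC.
pose f := (\1 - projv U)%VF.
suff /eqP : f v = 0.
  by rewrite !lfunE/= !lfunE/= subr_eq0 => /eqP ->; rewrite memv_proj.
apply/matrixP => i j; rewrite ord1 [RHS]mxE.
pose g (u : V) : R^o := f u i 0.
have gl : linear g by move=> c u w; rewrite /g linearP !mxE.
pose G := HB.pack_for {linear V -> R^o} g (GRing.isLinear.Build _ _ _ _ g gl).
have [t tP] := riesz G.
suff tT : t \in T by rewrite -[LHS]/(G v) tP Tv.
apply/TP => u uU; rewrite innerC -tP /= /g /f.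
by rewrite !lfunE/= !lfunE/= projv_id// subrr mxE.
Qed.
End Inner.

(** * Compactness of the unit ball and maximizing atoms; topology is done on row vectors with the
    sup norm, and [N] is carried over by transposition *)

Section NormCompact.
Import numFieldTopology.Exports numFieldNormedType.Exports.
Variables (R : realType) (n : nat) (N : 'cV[R]_n -> R).
Hypothesis hN : is_norm N.

Lemma norm_vec0 : N 0 = 0.
Proof. by rewrite -(scale0r 0) (norm_homog hN) normr0 mul0r. Qed.

Lemma norm_vecN x : N (- x) = N x.
Proof. by rewrite -scaleN1r (norm_homog hN) normrN1 mul1r. Qed.

Lemma norm_vec_ge0 x : 0 <= N x.
Proof.
have := norm_triangle hN x (- x); rewrite subrr norm_vec0 norm_vecN; lra.
Qed.

Lemma norm_vec_gt0 x : x != 0 -> 0 < N x.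
Proof.
move=> x0; rewrite lt0r norm_vec_ge0 andbT.
by apply: contra x0 => /eqP /(norm_definite hN) ->.
Qed.

Lemma norm_vec_sum (I : finType) (F : I -> 'cV[R]_n) :
  N (\sum_i F i) <= \sum_i N (F i).
Proof.
elim/big_rec2: _ => [|i s x _ IH]; first by rewrite norm_vec0.
by apply: le_trans (norm_triangle hN _ _) _; rewrite lerD2l.
Qed.

Lemma norm_vec_dist x y : `|N x - N y| <= N (x - y).
Proof.
have := norm_triangle hN (x - y) y; have := norm_triangle hN (y - x) x.
rewrite !subrK -(norm_vecN (x - y)) opprB => ? ?.
by rewrite ler_norml; apply/andP; split; lra.
Qed.

Lemma coord_le_norm (v : 'rV[R]_n) i : `|v 0 i| <= `|v|.
Proof. by rewrite [leRHS]/Num.norm /= mx_normrE; apply: (le_bigmax _ _ (0, i)). Qed.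

Lemma norm_vec_le : exists2 C, 0 < C & forall v : 'rV[R]_n, N v^T <= C * `|v|.
Proof.
(* The summand 1 keeps the constant positive even when the sum is empty. *)
exists (1 + \sum_i N (delta_mx i 0)) => [|v].
  by rewrite ltr_pwDl// sumr_ge0// => i _; exact: norm_vec_ge0.
rewrite {1}[v^T]matrix_sum_delta.
apply: le_trans (norm_vec_sum _) _; rewrite mulrDl mul1r ler_wpDl// mulr_suml.
apply: ler_sum => i _; rewrite big_ord1 (norm_homog hN) mulrC mxE.
by rewrite ler_wpM2l ?norm_vec_ge0// coord_le_norm.
Qed.

Lemma norm_vec_continuous : continuous (fun v : 'rV[R]_n => N v^T).
Proof.
have [C C0 NC] := norm_vec_le; move=> v s /= /(nbhs_ballP (N v^T)) [e e0 es].
apply/nbhs_ballP; exists (e / C) => [|w]; first exact: divr_gt0.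
rewrite -ball_normE /= => vw; apply: es; rewrite -ball_normE /=.
apply: le_lt_trans (norm_vec_dist _ _) _; rewrite -linearB/=.
by apply: le_lt_trans (NC _) _; rewrite mulrC -ltr_pdivlMr.
Qed.

(** [c] is the minimum of [N] on the compact sup-norm unit sphere, positive by definiteness;
    homogeneity extends the bound to all vectors. *)
Lemma norm_vec_lower : exists2 c, 0 < c & forall v : 'rV[R]_n, c * `|v| <= N v^T.
Proof.
pose S := [set v : 'rV[R]_n | `|v| = 1].
have cS : compact S.
  apply: bounded_closed_compact.
    by exists 1; split=> // M M1 v /= ->; exact: ltW.
  apply: (@preimage_closed _ _ (fun v : 'rV[R]_n => `|v|) [set x | x = 1]) => [v _|].
    exact: norm_continuous.
  exact: closed_eq.
have nS v : v != 0 -> S (`|v|^-1 *: v).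
  by move=> v0; rewrite /S /= normrZ normfV normr_id mulVf// normr_eq0.
(* An empty sphere means that 0 is the only vector, and then any constant works. *)
have [S_neq0|S0] := pselect (S !=set0); last first.
  exists 1 => // v; have [->|/nS Sv] := eqVneq v 0.
    by rewrite normr0 mulr0 norm_vec_ge0.
  by case: S0; exists (`|v|^-1 *: v).
have [|c Sc cmin] := @compact_EVT_min _ R (fun v => N v^T) S S_neq0 cS.
  exact/continuous_subspaceT/norm_vec_continuous.
exists (N c^T) => [|v].
  apply: norm_vec_gt0; apply: contraPneq Sc => /(congr1 trmx).
  by rewrite trmxK trmx0 => ->; rewrite inE /S /= normr0 => /esym/eqP; rewrite oner_eq0.
have [->|v_neq0] := eqVneq v 0; first by rewrite normr0 mulr0 norm_vec_ge0.
have := cmin _ (mem_set (nS _ v_neq0)).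
rewrite linearZ/= (norm_homog hN) normfV normr_id mulrC ler_pdivlMr//.
by rewrite normr_gt0.
Qed.

Lemma unit_ball_compact : compact [set v : 'rV[R]_n | N v^T <= 1].
Proof.
have [c c0 Nc] := norm_vec_lower.
apply: bounded_closed_compact; last first.
  apply: (@preimage_closed _ _ (fun v : 'rV[R]_n => N v^T) [set x | x <= 1]) => [v _|].
    exact: norm_vec_continuous.
  exact: closed_le.
exists c^-1; split=> [|M cM v /= Nv]; first by rewrite realV gtr0_real.
apply: le_trans (ltW cM); rewrite -[c^-1]mul1r ler_pdivlMr// mulrC.
exact: le_trans (Nc v) Nv.
Qed.

Variables (B : 'M[R]_n).
Hypothesis hB : sym_posdef B.

Lemma inner_continuous (y : 'cV[R]_n) :
  continuous (fun v : 'rV[R]_n => inner B y v^T).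
Proof.
have -> : (fun v : 'rV[R]_n => inner B y v^T) =
    fun v : 'rV[R]_n => \sum_j (y^T *m B) 0 j * v 0 j.
  by apply/funext => v; rewrite /inner mxE; apply: eq_bigr => j _; rewrite [v^T _ _]mxE.
apply: continuous_big; first exact: add_continuous.
move=> j _ v; apply: (@cvgM _ _ _ (nbhs_filter v) (fun=> _) (fun v => v 0 j)).
  exact: (@cvg_cst _ _ _ _ (nbhs_filter v)).
exact: coord_continuous.
Qed.

Lemma sqr_inner_continuous :
  continuous (fun v : 'rV[R]_n => inner B v^T v^T).
Proof.
have -> : (fun v : 'rV[R]_n => inner B v^T v^T) =
    fun v : 'rV[R]_n => \sum_j inner B (delta_mx j 0) v^T * v 0 j.
  apply/funext => v; rewrite [in LHS]/inner mxE; apply: eq_bigr => j _.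
  by rewrite [v^T _ _]mxE (innerC hB) /inner -colE [col _ _ _ _]mxE.
apply: continuous_big; first exact: add_continuous.
move=> j _ v; apply: (@cvgM _ _ _ (nbhs_filter v) (fun v => inner B _ v^T)
  (fun v => v 0 j)); first exact: inner_continuous.
exact: coord_continuous.
Qed.

(* The point of largest Euclidean norm in the face where [<y, .>] is maximal is
   extreme, by strict convexity of the Euclidean norm. *)
Lemma atom_maximizes y :
  exists2 a, atoms N a & forall u, N u <= 1 -> inner B y u <= inner B y a.
Proof.
pose K := [set v : 'rV[R]_n | N v^T <= 1].
have K0 : K !=set0 by exists 0; rewrite /K /= trmx0 norm_vec0.
have [|m /set_mem Km mmax] := @compact_EVT_max _ R (fun v => inner B y v^T) K K0
  unit_ball_compact.
  exact/continuous_subspaceT/inner_continuous.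
pose F := K `&` [set v | inner B y v^T = inner B y m^T].
have cF : compact F.
  apply: compact_closedI; first exact: unit_ball_compact.
  apply: (@preimage_closed _ _ (fun v : 'rV[R]_n => inner B y v^T)
    [set x | x = inner B y m^T]) => [v _|]; first exact: inner_continuous.
  exact: closed_eq.
have F0 : F !=set0 by exists m.
have [|a /set_mem[Ka aF] amax] :=
  @compact_EVT_max _ R (fun v => inner B v^T v^T) F F0 cF.
  exact/continuous_subspaceT/sqr_inner_continuous.
have ymax u : N u <= 1 -> inner B y u <= inner B y a^T.
  by move=> Nu; rewrite aF -[u]trmxK mmax// inE /K /= trmxK.
exists a^T => //; split=> // u v t Nu Nv t0 t1 auv.
(* The maximum at [a^T] is a proper convex combination of the values at [u] and [v], so both points
   lie in the face. *)
have [yu yv] : inner B y u = inner B y a^T /\ inner B y v = inner B y a^T.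
  have := ymax _ Nu; have := ymax _ Nv; have := congr1 (inner B y) auv.
  rewrite !innerE//; set p := inner B y _; set q := inner B y u.
  by set r := inner B y v; split; nra.
have sq w : N w <= 1 -> inner B y w = inner B y a^T ->
    inner B w w <= inner B a^T a^T.
  by move=> Nw yw; rewrite -[w]trmxK amax// inE; split; rewrite /K /= trmxK// yw.
have uv : u = v.
  apply/eqP; rewrite -subr_eq0; apply/eqP/(inner_eq0 hB).
  have := sq _ Nu yu; have := sq _ Nv yv.
  have := inner_ge0 hB (u - v).
  rewrite auv !innerE// (innerC hB v u).
  set p := inner B u u; set q := inner B v v; set r := inner B u v.
  move=> H0 H1 H2.
  (* With [p] and [q] the squared lengths of [u] and [v], [(1 - t) p + t q - <a, a> = (1 - t) t <u -
     v, u - v>]; the left side is at most 0 by maximality of [a]. *)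
  have H3 : (1 - t) * t * (p - r + (- r + q)) <= 0 by nra.
  have tt : 0 < (1 - t) * t by rewrite mulr_gt0// subr_gt0.
  by apply/eqP; rewrite eq_le; apply/andP; split; nra.
by rewrite auv uv -scalerDl subrK scale1r.
Qed.
End NormCompact.

(** * The dual unit ball, atoms and subgradients *)

Section AtomicNorm.
Variables (R : realType) (n : nat) (B : 'M[R]_n) (N : 'cV[R]_n -> R).
Hypotheses (hB : sym_posdef B) (hN : is_norm N) (hG : atoms N `<=` sphere B).
Local Notation V := ('cV[R]_n).
Local Notation "<< x , y >>" := (inner B x y).

(** The homogeneous form of membership in the dual unit ball, which avoids handling a supremum. *)
Definition polar (z : V) : Prop := forall x, <<z, x>> <= N x.

Lemma polar_unit_ball z : (forall u, N u <= 1 -> <<z, u>> <= 1) -> polar z.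
Proof.
move=> zu x; have [->|x0] := eqVneq x 0; first by rewrite inner0r norm_vec0.
have Nx := norm_vec_gt0 hN x0.
have := zu ((N x)^-1 *: x); rewrite innerZr (norm_homog hN) normfV gtr0_norm//.
rewrite mulVf ?gt_eqF// lexx => /(_ isT).
by rewrite mulrC ler_pdivrMr// mul1r.
Qed.

(** The maximizing atom shows that the set under the supremum is nonempty and bounded, so [sup] is
    not a default value. *)
Lemma dual_norm_le1 z : dual_norm B N z <= 1 <-> polar z.
Proof.
have [a [Na _] amax] := atom_maximizes hN hB z.
split=> [z1|zN]; last first.
  apply: ge_sup; first by exists (<<z, a>>); exists a.
  by move=> _ [u Nu <-]; apply: le_trans (zN u) Nu.
apply: polar_unit_ball => u Nu; apply: le_trans z1.
apply: ub_le_sup; last by exists u.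
by exists (<<z, a>>) => _ [w Nw <-]; exact: amax.
Qed.

Lemma polar_atoms z : (forall b, atoms N b -> <<z, b>> <= 1) -> polar z.
Proof.
move=> zb; have [a Aa amax] := atom_maximizes hN hB z.
by apply: polar_unit_ball => u /amax /le_trans; apply; exact: zb.
Qed.

Lemma polar_le1 z b : polar z -> atoms N b -> <<z, b>> <= 1.
Proof. by move=> zN [Nb _]; apply: le_trans (zN b) Nb. Qed.

Lemma atom_inner a : atoms N a -> <<a, a>> = 1.
Proof. by move/hG/(sphere_inner hB). Qed.

Lemma polar_atom a : atoms N a -> polar a.
Proof.
by move=> /hG Sa; apply: polar_atoms => b /hG Sb; exact: sphere_inner_le1.
Qed.

Lemma atom_norm a : atoms N a -> N a = 1.
Proof.
move=> Aa; apply: le_anti; rewrite Aa.1 -(atom_inner Aa).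
exact: polar_atom.
Qed.

Lemma polar0 : polar 0.
Proof. by move=> x; rewrite (inner0l hB) norm_vec_ge0. Qed.

Lemma polarN z : polar z -> polar (- z).
Proof. by move=> zN x; rewrite (innerNl hB) -innerNr -(norm_vecN hN). Qed.

Lemma polar_convex (s t : R) u v :
  0 <= s -> 0 <= t -> s + t = 1 -> polar u -> polar v ->
  polar (s *: u + t *: v).
Proof.
move=> s0 t0 st uN vN x; rewrite !(innerE hB) -[N x]mul1r -st mulrDl.
by rewrite lerD// ler_wpM2l.
Qed.

Lemma polar_segment (t : R) u v :
  `|t| <= 1 -> polar (u + v) -> polar (- u + v) -> polar (t *: u + v).
Proof.
rewrite ler_norml => /andP[t1 t2] uv uNv.
have -> : t *: u + v = ((1 + t) / 2) *: (u + v) + ((1 - t) / 2) *: (- u + v).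
  rewrite !scalerDr scalerN addrACA -scalerBl -scalerDl.
  by congr (_ *: _ + _); [field | rewrite -[LHS]scale1r; congr (_ *: _); field].
by apply: polar_convex => //; lra.
Qed.

Lemma subdiffP x z : subdiff B N x z <-> polar z /\ <<z, x>> = N x.
Proof.
rewrite /subdiff /=; split=> [sz|[zN zx] y]; last first.
  by rewrite innerBr zx addrC subrK.
have zx : <<z, x>> = N x.
  (* Testing at 0 gives [N x <= <z, x>], and testing at [2 x] gives the reverse. *)
  have := sz 0; have := sz (2%:R *: x).
  rewrite !innerBr innerZr inner0r (norm_vec0 hN) (norm_homog hN) ger0_norm//.
  lra.
split=> // y; have := sz y; rewrite innerBr zx; lra.
Qed.

Lemma argmax_atoms_exists x : exists a, argmax_atoms B N x a.
Proof.
have [a Aa amax] := atom_maximizes hN hB x.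
by exists a; split=> // b [Nb _]; rewrite !(innerC hB _ x) amax.
Qed.

Lemma argmax_atoms_le x a u :
  argmax_atoms B N x a -> N u <= 1 -> <<x, u>> <= <<x, a>>.
Proof.
move=> [Aa amax]; have [b Ab bmax] := atom_maximizes hN hB x.
by move=> /bmax /le_trans; apply; rewrite !(innerC hB x) amax.
Qed.

(** The maximum over the ball is at least the value at [x / N x], which is positive. *)
Lemma argmax_atoms_gt0 x a :
  x != 0 -> argmax_atoms B N x a -> 0 < <<x, a>>.
Proof.
move=> x0 amax; have Nx := norm_vec_gt0 hN x0.
have xx : 0 < <<x, x>> by apply: hB.2.
apply: lt_le_trans (_ : 0 < <<x, (N x)^-1 *: x>>) _.
  by rewrite innerZr mulr_gt0// invr_gt0.
apply: argmax_atoms_le amax _.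
by rewrite (norm_homog hN) normfV gtr0_norm// mulVf// gt_eqF.
Qed.

Lemma argmax_atoms_polar x a (c := <<x, a>>) :
  x != 0 -> argmax_atoms B N x a ->
  polar (c^-1 *: x) /\ <<c^-1 *: x, a>> = 1.
Proof.
move=> x0 amax; have c0 : 0 < c := argmax_atoms_gt0 x0 amax.
rewrite (innerZl hB) mulVf ?gt_eqF//; split=> //.
apply: polar_unit_ball => u /(argmax_atoms_le amax) xu.
by rewrite (innerZl hB) mulrC ler_pdivrMr// mul1r.
Qed.

(** * From decomposability to orthogonal atomic representations *)

Section Decompose.

Hypothesis dec : decomposable B N.

(** [P] is the orthogonal of T_a; the clauses restate the shape of the subdifferential at [a] once
    its center is known to be [a]. *)
Lemma atom_decomposition a : atoms N a -> exists P : {vspace V},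
  [/\ forall v, v \in P -> <<v, a>> = 0,
      forall v, v \in P -> polar v -> polar (a + v) &
      forall z, polar z -> <<z, a>> = 1 -> z - a \in P /\ polar (z - a)].
Proof.
move=> Aa; have [T [e [eT sub]]] := dec a.
have [P PT] := orth_linear B T.
have subE z : polar z /\ <<z, a>> = 1 <-> exists v, [/\ orth B T v, polar v & z = e + v].
  rewrite -(atom_norm Aa) -subdiffP sub; split=> [[v /= [Tv /dual_norm_le1 vN] <-]|].
    by exists v.
  by move=> [v [Tv /dual_norm_le1 vN ->]]; exists v.
have [v [Tv _ av]] : exists v, [/\ orth B T v, polar v & a = e + v].
  by apply/subE; rewrite atom_inner//; split => //; exact: polar_atom.
have [eN ea] : polar e /\ <<e, a>> = 1.
  apply/subE; exists 0; split; [by move=> t _; exact: inner0r|exact: polar0|].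
  by rewrite addr0.
have {v Tv av} e_a : e = a.
  apply/eqP; rewrite -subr_eq0; apply/eqP/(inner_eq0 hB).
  have := atom_inner Aa; have := ea; rewrite av !(innerE hB) (Tv _ eT).
  rewrite (innerC hB v e) (Tv _ eT); lra.
exists P; rewrite e_a in eT subE; split=> [v /PT Pv|v /PT Pv vN|z zN za].
- by rewrite innerC// Pv.
- by apply: (proj1 (_ : _ /\ <<a + v, a>> = 1)); apply/subE; exists v.
- have [v [Tv vN ->]] := (subE z).1 (conj zN za).
  by rewrite addrC addKr; split => //; apply/PT.
Qed.

(** The invariant of the greedy construction: atoms chosen for a residual in [U] stay in [U]. It is
    stable under intersection. *)
Definition argmax_closed (U : {vspace V}) : Prop :=
  forall x b, x \in U -> x != 0 -> argmax_atoms B N x b -> b \in U.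

(** Scale [x] so that it is a subgradient at [b]. Polarity of [a + x] and [a - x] forces
    [<a, b> = 0], so [a + x] is also a subgradient at [b], and the difference [a] lies in the
    subspace [Q] of [b]. Hence [b + a] is polar with product 1 against [a], which puts [b] in
    [P]. *)
Lemma atom_decomposition_closed a (P : {vspace V}) : atoms N a ->
  (forall v, v \in P -> <<v, a>> = 0) ->
  (forall v, v \in P -> polar v -> polar (a + v)) ->
  (forall z, polar z -> <<z, a>> = 1 -> z - a \in P /\ polar (z - a)) ->
  argmax_closed P.
Proof.
move=> Aa Pa0 PaD PaB x b xP x0 bmax; have Ab := bmax.1.
have [yN yb] := argmax_atoms_polar x0 bmax.
have : (<<x, b>>)^-1 *: x \in P by rewrite memvZ.
(* From here on [x] denotes the rescaled vector. *)
move: (_ *: x) yN yb => {bmax x0 xP}x xN xb xP.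
have axN : polar (a + x) by exact: PaD.
have aNxN : polar (a + - x) by apply: PaD; [rewrite memvN|exact: polarN].
have ab : <<a, b>> = 0.
  have := polar_le1 axN Ab; have := polar_le1 (polarN aNxN) Ab.
  rewrite !(innerE hB) xb; lra.
have [Q [Qb0 QbD QbB]] := atom_decomposition Ab.
have aQ : a \in Q.
  have [xQ _] := QbB _ xN xb.
  have [|axQ _] := QbB _ axN; first by rewrite !(innerE hB) ab xb add0r.
  have aE : (a + x - b) - (x - b) = a by rewrite opprB addrA subrK addrK.
  by rewrite -aE rpredB.
have [|+ _] := PaB (b + a) (QbD _ aQ (polar_atom Aa)).
  by rewrite !(innerE hB) (innerC hB) ab atom_inner// add0r.
by rewrite addrK.
Qed.

(** Induction on the dimension of [U]: the residual [x - c a1] lies in [U :&: P], which is smaller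
    because it misses [a1]. *)
Lemma greedy_decomposition (U : {vspace V}) x a1 :
  argmax_closed U -> x \in U -> x != 0 -> argmax_atoms B N x a1 ->
  exists (k : nat) (a : 'I_k.+1 -> V) (g : 'I_k.+1 -> R),
    [/\ a ord0 = a1, (forall i, atoms N (a i) /\ a i \in U),
        orthogonal_family B a, ((forall i, 0 < g i) /\ x = \sum_i g i *: a i) &
        forall h, (forall i, `|h i| <= 1) -> polar (\sum_i h i *: a i)].
Proof.
have [d] := ubnP (\dim U); elim: d U x a1 => // d IH U x a1 dU Ucl xU x0 amax.
have Aa := amax.1; have a1U := Ucl _ _ xU x0 amax.
have c0 := argmax_atoms_gt0 x0 amax.
have [yN yb] := argmax_atoms_polar x0 amax.
have [P [Pa0 PaD PaB]] := atom_decomposition Aa.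
have Pcl := atom_decomposition_closed Aa Pa0 PaD PaB.
set c := <<x, a1>> in c0 yN yb.
(* Both [a1 + v] and [- a1 + v = - (a1 - v)] are polar; convexity covers the coefficients in
   between. *)
have a1N h v : `|h| <= 1 -> v \in P -> polar v -> polar (h *: a1 + v).
  move=> h1 vP vN; apply: polar_segment h1 (PaD _ vP vN) _.
  by rewrite -[v]opprK -opprD; apply/polarN/PaD; [rewrite memvN|exact: polarN].
pose y := x - c *: a1.
have yP : y \in P.
  have [/(memvZ c) + _] := PaB _ yN yb.
  by rewrite scalerBr scalerA divff ?gt_eqF// scale1r.
have yU : y \in U by rewrite rpredB// memvZ.
have xE : x = c *: a1 + y by rewrite addrC subrK.
have [y0|y_neq0] := eqVneq y 0.
  exists 0%N, (fun=> a1), (fun=> c); split=> //.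
  - by move=> i j; rewrite !ord1.
  - by split=> //; rewrite big_ord1 {1}xE y0 addr0.
  - move=> h h1; rewrite big_ord1 -[_ *: _]addr0.
    by apply: a1N; [exact: h1|exact: mem0v|exact: polar0].
have a1P : a1 \notin P.
  by apply/negP => /Pa0 /eqP; rewrite atom_inner// oner_eq0.
have [a2 a2max] := argmax_atoms_exists y.
have dUP : (\dim (U :&: P) < d)%N.
  rewrite ltnS in dU; apply: leq_trans dU.
  rewrite ltn_neqAle dimvS ?capvSl// andbT; apply: contra a1P => /eqP dE.
  have /eqP UPE : (U :&: P)%VS == U by rewrite eqEdim capvSl dE leqnn.
  by move: a1U; rewrite -UPE memv_cap => /andP[].
have UPcl : argmax_closed (U :&: P).
  move=> z b; rewrite !memv_cap => /andP[zU zP] z0 bmax.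
  by rewrite (Ucl _ _ zU z0 bmax) (Pcl _ _ zP z0 bmax).
have [|k [a [g [_ Aa' oa [g0 yE] ha]]]] := IH _ y a2 dUP UPcl _ y_neq0 a2max.
  by rewrite memv_cap yU.
have aP i : a i \in P by have [_] := Aa' i; rewrite memv_cap => /andP[].
have aU i : a i \in U by have [_] := Aa' i; rewrite memv_cap => /andP[].
(* Prepends an entry to a family; it serves for atoms and for coefficients. *)
pose ext (T : Type) (u : T) (f : 'I_k.+1 -> T) (i : 'I_k.+2) : T :=
  oapp f u (unlift ord0 i).
have ext0 T u f : @ext T u f ord0 = u by rewrite /ext unlift_none.
have extS T u f i : @ext T u f (lift ord0 i) = f i by rewrite /ext liftK.
exists k.+1, (ext _ a1 a), (ext _ c g); split.
- exact: ext0.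
- move=> i; case: (unliftP ord0 i) => [j|] ->; rewrite ?extS ?ext0 //.
  by split=> //; case: (Aa' j).
- move=> i j; case: (unliftP ord0 i) => [i'|] ->; case: (unliftP ord0 j) => [j'|] ->;
    rewrite ?extS ?ext0 ?eqxx//.
  + by rewrite (inj_eq lift_inj); exact: oa.
  + by rewrite Pa0.
  + by rewrite innerC// Pa0.
- split=> [i|]; first by case: (unliftP ord0 i) => [j|] ->; rewrite ?extS ?ext0.
  by rewrite big_ord_recl !ext0 {1}xE yE; congr (_ + _); apply: eq_bigr => i _;
    rewrite !extS.
- move=> h h1; rewrite big_ord_recl ext0; apply: a1N => //.
    by apply: rpred_sum => i _; rewrite extS memvZ.
  by under eq_bigr do rewrite extS; apply: ha.
Qed.

Lemma decomposable_atomic x a1 : x != 0 -> argmax_atoms B N x a1 ->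
  exists (k : nat) (a : 'I_k.+1 -> V),
    [/\ a ord0 = a1, (forall i, atoms N (a i)), orthogonal_family B a,
        atomic_rep N a x & dual_bounded B N a].
Proof.
move=> x0 amax.
have [//||k [a [g [a0 Aa oa [g0 xE] ha]]]] :=
  @greedy_decomposition fullv x a1 _ _ x0 amax; rewrite ?memvf//.
  by move=> *; rewrite memvf.
have Aa' i : atoms N (a i) by case: (Aa i).
exists k, a; split=> // [|h h1]; last by apply/dual_norm_le1; exact: ha.
(* The triangle inequality gives [N x <= sum g]; polarity of the sum of the atoms, tested at [x],
   gives the reverse. *)
exists g; split=> //; apply: le_anti; apply/andP; split.
  rewrite xE; apply: le_trans (norm_vec_sum hN _) _; apply: ler_sum => i _.
  by rewrite (norm_homog hN) atom_norm// mulr1 gtr0_norm.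
have h1 i : `|(fun _ : 'I_k.+1 => 1 : R) i| <= 1 by rewrite normr1.
have := ha _ h1 x.
congr (_ <= _); rewrite {1}xE inner_sumr; apply: eq_bigr => i _.
by rewrite (inner_orthonormal_sum hB) ?mulr1// => j; apply: hG.
Qed.

End Decompose.

(** * Consequences of conditions (I) and (II) *)

Lemma dual_bounded_orthogonal k (a : 'I_k -> V) :
  (forall i, atoms N (a i)) -> dual_bounded B N a -> orthogonal_family B a.
Proof.
move=> Aa ha i j ij.
(* The polar vector [a j + s a i] is tested against [a j]; the values 1 and -1 of [s] then force
   orthogonality. *)
have H (s : R) : `|s| <= 1 -> 1 + s * <<a i, a j>> <= 1.
  move=> s1; pose h l : R := if l == j then 1 else if l == i then s else 0.
  have h1 l : `|h l| <= 1.
    by rewrite /h; case: ifP => _; [rewrite normr1|case: ifP; rewrite ?normr0].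
  have /dual_norm_le1/polar_le1/(_ (Aa j)) := ha _ h1.
  rewrite (inner_suml hB) (bigD1 j)//= (bigD1 i)//= big1 => [|l /andP[lj li]].
    by rewrite addr0 /h !eqxx (negbTE ij) atom_inner// mulr1.
  by rewrite /h (negbTE lj) (negbTE li) mul0r.
have := H 1; have := H (-1); rewrite normrN1 normr1 lexx => /(_ isT) + /(_ isT).
lra.
Qed.

(** A sum of the inequalities [<z, a i> <= 1] with positive weights is an equality only if each of
    them is. *)
Lemma atomic_rep_subdiff k (a : 'I_k -> V) x z :
  (forall i, atoms N (a i)) -> atomic_rep N a x -> polar z ->
  <<z, x>> = N x <-> forall i, <<z, a i>> = 1.
Proof.
move=> Aa [g [g0 xE NE]] zN; rewrite NE xE inner_sumr; split=> [zx i|za].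
  apply: le_anti; rewrite polar_le1//= leNgt; apply/negP => zi.
  suff : \sum_i g i * <<z, a i>> < \sum_i g i by rewrite zx ltxx.
  rewrite (bigD1 i)//= [ltRHS](bigD1 i)//= ltr_leD//.
    by rewrite -[ltRHS]mulr1 ltr_pM2l.
  apply: ler_sum => j _; rewrite -[leRHS]mulr1 ler_wpM2l//; first exact: ltW.
  exact: polar_le1.
by apply: eq_bigr => i _; rewrite za mulr1.
Qed.

(** * From atomic representations to decomposability *)

Section Recompose.

Hypothesis rep : forall x, x != 0 -> forall a1, argmax_atoms B N x a1 ->
  exists (k : nat) (a : 'I_k.+1 -> V),
    [/\ a ord0 = a1, (forall i, atoms N (a i)), orthogonal_family B a,
        atomic_rep N a x & dual_bounded B N a].

(* Apply the hypothesis to [z = a + eps v]: the coefficient of [a] is [<z, a> = 1],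
   and the other ones, divided by [eps], are the [<v, b>], hence at most 1. *)
Lemma polar_atom_extend a v (eps : R) : atoms N a -> 0 < eps ->
  <<v, a>> = 0 -> polar (a + eps *: v) ->
  (forall b, atoms N b -> <<a, b>> = 0 -> <<v, b>> <= 1) ->
  forall t : R, `|t| <= 1 -> polar (t *: a + v).
Proof.
move=> Aa eps0 va zN vb t t1; set z := a + eps *: v in zN.
have za : <<z, a>> = 1 by rewrite !(innerE hB) va atom_inner// mulr0 addr0.
have z0 : z != 0.
  by apply: contra_eq_neq za => ->; rewrite inner0l// eq_sym oner_neq0.
have amax : argmax_atoms B N z a.
  by split=> // b Ab; rewrite !(innerC hB _ z) za polar_le1.
have [k [c [c0 Ac oc [g [g0 zE _]] hc]]] := rep z0 amax.
have gE i : <<z, c i>> = g i.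
  by rewrite zE (inner_orthonormal_sum hB)// => j; exact: hG.
have g01 : g ord0 = 1 by rewrite -gE c0.
have gS i : g (lift ord0 i) = eps * <<v, c (lift ord0 i)>>.
  by rewrite -gE !(innerE hB) -c0 oc// add0r.
have vE : v = \sum_i <<v, c (lift ord0 i)>> *: c (lift ord0 i).
  apply: (scalerI (lt0r_neq0 eps0)); apply: (addrI a).
  rewrite -/z [LHS]zE big_ord_recl g01 scale1r c0 scaler_sumr; congr (_ + _).
  by apply: eq_bigr => i _; rewrite gS scalerA.
pose h i := if i == ord0 then t else <<v, c i>>.
have -> : t *: a + v = \sum_i h i *: c i.
  by rewrite big_ord_recl c0; congr (_ + _).
apply/dual_norm_le1/hc => i; rewrite /h; case: (unliftP ord0 i) => [j|] -> //.
(* [<v, c i>] is a positive coefficient divided by [eps], so an upper bound suffices. *)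
rewrite ger0_norm.
  by apply: vb => //; rewrite -c0 oc.
by rewrite -(pmulr_rge0 _ eps0) -gS ltW.
Qed.

Section Sum.

Variables (k : nat) (a : 'I_k -> V).
Hypotheses (Aa : forall i, atoms N (a i)) (oa : orthogonal_family B a).
Let sum_inner h i : <<\sum_l h l *: a l, a i>> = h i.
Proof. by rewrite (inner_orthonormal_sum hB)// => j; exact: hG. Qed.

(** The coefficients are changed one index at a time, [r] listing those already treated. Each change
    is [polar_atom_extend] with [eps = 1] applied to [w - a i]; orthogonality leaves the other
    products untouched. *)
Lemma polar_sum_rescale z (h : 'I_k -> R) : polar z ->
  (forall i, <<z, a i>> = 1) -> (forall i, `|h i| <= 1) ->
  polar (z + \sum_i (h i - 1) *: a i).
Proof.
move=> zN za h1.
suff H (r : seq 'I_k) :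
    polar (z + \sum_i (if i \in r then h i - 1 else 0) *: a i).
  have := H (enum 'I_k); congr polar; congr (_ + _).
  by apply: eq_bigr => i _; rewrite mem_enum.
elim: r => [|i r IH].
  rewrite big1 ?addr0// => i _; exact: scale0r.
have [ir|ir] := boolP (i \in r).
  move: IH; congr polar; congr (_ + _); apply: eq_bigr => l _.
  by rewrite inE; case: eqVneq => [->|//]; rewrite ir.
set w := (X in polar X) in IH.
have wi : <<w, a i>> = 1 by rewrite !(innerE hB) sum_inner za (negbTE ir) addr0.
have -> : z + \sum_l (if l \in i :: r then h l - 1 else 0) *: a l =
    h i *: a i + (w - a i).
  rewrite (bigD1 i)//= inE eqxx scalerBl scale1r addrCA -!addrA; congr (_ + _).
  rewrite addrC /w -addrA; congr (z + (_ - _)).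
  rewrite [RHS](bigD1 i)//= (negbTE ir) scale0r add0r.
  by apply: eq_bigr => l li; rewrite inE (negbTE li).
apply: (@polar_atom_extend _ _ 1) => //.
- by rewrite innerBl// wi atom_inner// subrr.
- by rewrite scale1r addrC subrK.
- by move=> b Ab ib; rewrite innerBl// ib subr0 polar_le1.
Qed.

Let e := \sum_i a i.

Let eE : e = \sum_i 1 *: a i.
Proof. by apply: eq_bigr => i _; rewrite scale1r. Qed.

Lemma polar_sum_perturb v (eps : R) (h : 'I_k -> R) : polar (e + eps *: v) ->
  (forall i, <<v, a i>> = 0) -> (forall i, `|h i| <= 1) ->
  polar (\sum_i h i *: a i + eps *: v).
Proof.
move=> evN va h1.
have -> : \sum_i h i *: a i + eps *: v =
    e + eps *: v + \sum_i (h i - 1) *: a i.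
  rewrite addrAC; congr (_ + _); rewrite eE -big_split/=.
  by apply: eq_bigr => i _; rewrite -scalerDl addrC subrK.
apply: polar_sum_rescale => // i.
by rewrite !(innerE hB) va mulr0 addr0 eE sum_inner.
Qed.

(** Starting from [v], the atoms are added one by one with [polar_atom_extend], whose bound on
    products comes from polarity of the current vector [w]. *)
Lemma polar_sum_extend v (eps : R) : 0 < eps -> eps <= 1 ->
  polar (e + eps *: v) -> (forall i, <<v, a i>> = 0) -> polar v ->
  polar (e + v).
Proof.
move=> eps0 eps1 evN va vN.
suff H (r : seq 'I_k) : polar (\sum_i (i \in r)%:R *: a i + v).
  have := H (enum 'I_k); congr polar; congr (_ + _).
  by apply: eq_bigr => i _; rewrite mem_enum scale1r.
elim: r => [|i r IH].
  by rewrite big1 ?add0r// => i _; exact: scale0r.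
have [ir|ir] := boolP (i \in r).
  move: IH; congr polar; congr (_ + _); apply: eq_bigr => l _.
  by rewrite inE; case: eqVneq => [->|//]; rewrite ir.
set w := (X in polar X) in IH.
have wi : <<w, a i>> = 0 by rewrite !(innerE hB) sum_inner va (negbTE ir) addr0.
have -> : \sum_l (l \in i :: r)%:R *: a l + v = 1 *: a i + w.
  rewrite addrA; congr (_ + _).
  rewrite (bigD1 i)//= [in RHS](bigD1 i)//= inE eqxx (negbTE ir) scale0r add0r.
  by congr (_ + _); apply: eq_bigr => l li; rewrite inE (negbTE li).
apply: (@polar_atom_extend _ _ eps) => //; last by rewrite normr1.
  (* The coefficients of [a i + eps w] along the atoms: 1 at [i], [eps] on [r], 0 elsewhere. They
     are at most 1 because [eps <= 1]. *)
  pose h l : R := if l == i then 1 else eps * (l \in r)%:R.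
  have -> : a i + eps *: w = \sum_l h l *: a l + eps *: v.
    rewrite scalerDr addrA; congr (_ + _); rewrite scaler_sumr.
    rewrite (bigD1 i)//= [in RHS](bigD1 i)//= /h eqxx (negbTE ir) scale1r.
    rewrite scale0r scaler0 add0r; congr (_ + _).
    by apply: eq_bigr => l li; rewrite (negbTE li) scalerA.
  apply: polar_sum_perturb => // l; rewrite /h; case: ifP => _.
    by rewrite normr1.
  by case: (l \in r); rewrite ?mulr0 ?normr0// mulr1 gtr0_norm.
by move=> b Ab _; exact: polar_le1.
Qed.

Lemma polar_sum_shrink v (s t : R) : polar e -> 0 <= s -> s <= t ->
  polar (e + t *: v) -> polar (e + s *: v).
Proof.
move=> eN; rewrite le_eqVlt => /predU1P[<- _ _|s0 st]; first by rewrite scale0r addr0.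
have t0 : 0 < t by apply: lt_le_trans st.
move=> etN; have st1 : s / t <= 1 by rewrite ler_pdivrMr// mul1r.
have -> : e + s *: v = (1 - s / t) *: e + (s / t) *: (e + t *: v).
  by rewrite scalerDr addrA -scalerDl subrK scale1r scalerA divfK// gt_eqF.
by apply: polar_convex => //; [rewrite subr_ge0|rewrite divr_ge0// ltW|rewrite subrK].
Qed.

(** Feasible directions at [e] in the face of the dual ball cut out by [<z, a i> = 1]. In general
    such directions only form a cone. *)
Definition face_dir (v : V) : Prop :=
  (forall i, <<v, a i>> = 0) /\ exists2 eps : R, 0 < eps & polar (e + eps *: v).

Lemma face_dir_linear : polar e ->
  exists U : {vspace V}, forall v, v \in U <-> face_dir v.
Proof.
move=> eN.
have neg v : face_dir v -> face_dir (- v).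
  move=> [va [eps eps0 evN]]; split=> [i|]; first by rewrite innerNl// va oppr0.
  (* Turning all coefficients into -1 makes [- e + eps v] polar; its opposite is [e - eps v]. *)
  exists eps => //; rewrite scalerN -[e]opprK -opprD; apply: polarN.
  have := @polar_sum_perturb v eps (fun=> -1) evN va (fun=> _).
  rewrite normrN1 lexx => /(_ (fun=> isT)); congr polar; congr (_ + _).
  by rewrite eE -sumrN; apply: eq_bigr => i _; rewrite scaleN1r scale1r.
have pos (c : R) v : 0 < c -> face_dir v -> face_dir (c *: v).
  move=> c0 [va [eps eps0 evN]]; split=> [i|]; first by rewrite innerZl// va mulr0.
  by exists (eps / c); [rewrite divr_gt0|rewrite scalerA divfK// gt_eqF].
have zero : face_dir 0.
  split=> [i|]; first exact: inner0l.
  by exists 1; rewrite // scaler0 addr0.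
have scale (c : R) v : face_dir v -> face_dir (c *: v).
  move=> fv; have [c0|c0|->] := ltrgt0P c; last by rewrite scale0r.
    exact: pos.
  by rewrite -[c *: v]opprK -scaleNr; apply/neg/pos => //; rewrite oppr_gt0.
apply: vspace_of_pred => // c u v /(scale c); move: (c *: u) => {}u.
move=> [ua [s s0 euN]] [va [t t0 evN]].
split=> [i|]; first by rewrite innerDl// ua va addr0.
(* The step length reached by combining [e + s u] and [e + t v] with weights [t / (s + t)] and
   [s / (s + t)]. *)
exists (s * t / (s + t)); first by rewrite divr_gt0 ?mulr_gt0 ?addr_gt0.
have st0 : s + t != 0 by rewrite gt_eqF// addr_gt0.
have -> : e + (s * t / (s + t)) *: (u + v) =
    (t / (s + t)) *: (e + s *: u) + (s / (s + t)) *: (e + t *: v).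
  rewrite !scalerDr !scalerA addrACA -scalerDl -mulrDl [t + s]addrC divff//.
  by rewrite scale1r; congr (_ + (_ *: _ + _ *: _)); ring.
apply: polar_convex => //; [| |by field].
- by rewrite divr_ge0 ?addr_ge0 ?ltW.
- by rewrite divr_ge0 ?addr_ge0 ?ltW.
Qed.

End Sum.

Lemma atomic_decomposable : decomposable B N.
Proof.
move=> x; have [->|x0] := eqVneq x 0.
  (* At the origin the subdifferential is the whole dual unit ball. *)
  exists 0%VS, 0; split; first exact: mem0v.
  apply/seteqP; split=> z /=.
    move=> /subdiffP[zN _]; exists z; last exact: add0r.
    split; last exact/dual_norm_le1.
    by move=> t; rewrite memv0 => /eqP ->; exact: inner0l.
  move=> [v [_ /dual_norm_le1 vN] <-]; rewrite add0r; apply/subdiffP.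
  by rewrite inner0r norm_vec0.
have [a1 a1max] := argmax_atoms_exists x.
have [k [a [_ Aa oa xa ha]]] := rep x0 a1max.
pose e := \sum_i a i.
have eE : e = \sum_i 1 *: a i by apply: eq_bigr => i _; rewrite scale1r.
have eN : polar e.
  by rewrite eE; apply/dual_norm_le1/ha => i; rewrite normr1.
have ea i : <<e, a i>> = 1.
  by rewrite eE (inner_orthonormal_sum hB)// => j; exact: hG.
have [U UP] := face_dir_linear Aa oa eN.
have [T [TU UT]] := orth_complement hB U.
exists T, e; split.
  apply: UT => u /UP[ua _]; rewrite eE inner_sumr big1// => i _.
  by rewrite ua mulr0.
apply/seteqP; split=> z /=.
  move=> /subdiffP[zN /(atomic_rep_subdiff Aa xa zN) za].
  exists (z - e); last by rewrite addrC subrK.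
  split.
    apply/TU/UP; split=> [i|]; first by rewrite innerBl// za ea subrr.
    by exists 1 => //; rewrite scale1r addrC subrK.
  apply/dual_norm_le1.
  (* Setting every coefficient of [z] to 0 yields [z - e]. *)
  have := polar_sum_rescale Aa oa zN za (h := fun=> 0) (fun=> _).
  rewrite normr0 ler01 => /(_ (fun=> isT)); congr polar; congr (_ + _).
  by rewrite -sumrN; apply: eq_bigr => i _; rewrite sub0r scaleN1r.
move=> [v [/TU/UP[va [eps eps0 evN]] /dual_norm_le1 vN] <-].
apply/subdiffP; suff evN' : polar (e + v).
  split=> //; apply/(atomic_rep_subdiff Aa xa evN') => i.
  by rewrite innerDl// ea va addr0.
(* [polar_sum_extend] asks for a step length at most 1, reached by shrinking [eps]. *)
have m0 : 0 < Num.min eps 1 by rewrite lt_min eps0 ltr01.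
apply: (polar_sum_extend Aa oa (eps := Num.min eps 1)) => //.
  by rewrite ge_min lexx orbT.
by apply: polar_sum_shrink evN => //; [exact: ltW|rewrite ge_min lexx].
Qed.

End Recompose.

(** * The formula for the center *)

Lemma decomposition_center k (a : 'I_k -> V) x T e :
  (forall i, atoms N (a i)) -> atomic_rep N a x -> dual_bounded B N a ->
  decomposed_at B N x T e -> e = \sum_i a i.
Proof.
move=> Aa xa ha [eT sub]; have oa := dual_bounded_orthogonal Aa ha.
pose e' := \sum_i a i; rewrite -/e'.
have eE : e' = \sum_i 1 *: a i by apply: eq_bigr => i _; rewrite scale1r.
have eN' : polar e'.
  by rewrite eE; apply/dual_norm_le1/ha => i; rewrite normr1.
have ea' i : <<e', a i>> = 1.
  by rewrite eE (inner_orthonormal_sum hB)// => j; exact: hG.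
have : subdiff B N x e'.
  by apply/subdiffP; split=> //; apply/(atomic_rep_subdiff Aa xa).
(* Here [e' = e + v] with [<e, v> = 0]. As [e] is a subgradient too, it has product 1 with each
   atom, so [<e, e'> = <e', e'>] and [v] vanishes. *)
rewrite sub => -[v [/= Tv _] e'E].
have : subdiff B N x e.
  rewrite sub; exists 0; last exact: addr0.
  split; first by move=> t _; exact: inner0r.
  exact/dual_norm_le1/polar0.
move=> /subdiffP[eN /(atomic_rep_subdiff Aa xa eN) ea].
have ee' : <<e, e'>> = <<e', e'>>.
  by rewrite eE !inner_sumr -eE; apply: eq_bigr => i _; rewrite ea ea'.
apply/eqP; rewrite -subr_eq0; apply/eqP/(inner_eq0 hB).
have := ee'; rewrite -e'E !(innerE hB) (innerC hB v e) (Tv _ eT); lra.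
Qed.

End AtomicNorm.

Unset Implicit Arguments.
Set Strict Implicit.

Theorem theorem1 (R : realType) (n : nat) (B : 'M[R]_n) (N : 'cV[R]_n -> R)
    (hB : sym_posdef B) (hN : is_norm N) (hG : atoms N `<=` sphere B) :
  (decomposable B N <->
   forall x : 'cV[R]_n, x != 0 ->
   forall a1 : 'cV[R]_n, argmax_atoms B N x a1 ->
   exists (k : nat) (a : 'I_k.+1 -> 'cV[R]_n),
     [/\ a ord0 = a1, (forall i, atoms N (a i)), orthogonal_family B a,
         atomic_rep N a x & dual_bounded B N a])
  /\
  (decomposable B N ->
   forall (x : 'cV[R]_n) (k : nat) (a : 'I_k.+1 -> 'cV[R]_n),
     (forall i, atoms N (a i)) -> atomic_rep N a x -> dual_bounded B N a ->
   forall (T : {vspace 'cV[R]_n}) (e : 'cV[R]_n),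
     decomposed_at B N x T e -> e = \sum_(i < k.+1) a i).
Proof.
split; first split=> [dec x x0 a1 amax|rep].
- exact: decomposable_atomic dec _ _ x0 amax.
- exact: atomic_decomposable rep.
- by move=> _ x k a Aa xa ha T e; apply: decomposition_center.
Qed.
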